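(* For every sufficiently large integer $r$ and every integer $n_0$, there exist $n>n_0$ and an $r$-edge-colouring of the complete graph $K_n$ whose vertex set cannot be partitioned into fewer than $(1-o(1))\,r\log\log r$ monochromatic paths, where $o(1)$ denotes a function of $r$ only, tending to $0$ as $r\to\infty$.
   Context: An $r$-edge-colouring of $K_n$ assigns to each edge one of $r$ colours (not necessarily properly, and not all colours need be used). A monochromatic path is a path all of whose edges have the same colour; a single vertex counts as a (trivial) monochromatic path. A partition of the vertex set into monochromatic paths is a collection of vertex-disjoint monochromatic paths covering all vertices. Logarithms are natural. *)

(* Defs.v *)
From HB Require Import structures.
From mathcomp Require Import all_boot all_order all_algebra.
From mathcomp Require Import all_classical all_reals all_analysis.

Set Implicit Arguments.
Unset Strict Implicit.
Unset Printing Implicit Defensive.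

(* The complete graph K_n has vertex set 'I_n.  An r-edge-colouring is given
   by its values on ordered pairs of vertices, hence must be symmetric; the
   values on the diagonal are irrelevant. *)
Definition edge_colouring (n r : nat) (c : 'I_n -> 'I_n -> 'I_r) : Prop :=
  forall x y : 'I_n, c x y = c y x.

Definition colour_edge (n r : nat) (c : 'I_n -> 'I_n -> 'I_r) (k : 'I_r) :
    rel 'I_n :=
  fun x y => (x != y) && (c x y == k).

(* A path is given by the list of its vertices in order; the empty list is
   not a path, and a one-vertex list is monochromatic in every colour. *)
Definition mono_path (n r : nat) (c : 'I_n -> 'I_n -> 'I_r) (p : seq 'I_n) :
    bool :=
  if p is x :: q then uniq p && [exists k : 'I_r, path (colour_edge c k) x q]
  else false.

(* The number of paths of the partition is size P. *)
Definition mono_path_partition (n r : nat) (c : 'I_n -> 'I_n -> 'I_r)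
    (P : seq (seq 'I_n)) : bool :=
  all (mono_path c) P && perm_eq (flatten P) (enum 'I_n).

(* Main.v *)
Require Import Defs.
From HB Require Import structures.
From mathcomp Require Import all_boot all_order all_algebra.
From mathcomp Require Import all_classical all_reals all_analysis.
From mathcomp Require Import zify ring lra.
Import Order.TTheory GRing.Theory Num.Theory.
Import numFieldNormedType.Exports.
Set Implicit Arguments.
Unset Strict Implicit.
Unset Printing Implicit Defensive.

(** Why the bound holds.  The vertices are arranged in l groups, each larger
    than all earlier ones together by a factor of order l^3, and every group
    consists of parts; all t parts have the same size.  A vertex v carries a
    cell x in 'I_m and a selector s_v, a sequence of t distinct elements of
    'I_d.  Inside a group an edge takes as its hue the larger of its two
    cells.  An edge from u in group g to v in a larger group takes the hue
    (g, s_u (part v)).  This uses m + l d hues in all.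

    Because selectors are injective, a monochromatic path of hue (g, c) visits
    only one part outside g, so it stays in a component labelled (g, j, c)
    with j a part; a path whose hue is a cell x stays in one group
    ([component_of_edge]).  The paths of a partition therefore use, for each
    group g, a set K of cells and sets U_j of links c, and the cardinals of
    all these sets, summed over all groups, do not exceed the number of paths.

    Fix g and let X be the vertices of g whose cell is not in K and whose
    selector avoids U_j for all j outside a small exceptional set J.  On a path
    of the partition, the successor of a vertex of X lies in an earlier group,
    in a part of J, or in a cell of g belonging to K, so X cannot be much
    larger than these three sets together ([group_inequality]).  The first two
    are negligible.  If the sets U_j have total size k, a random injective
    selector avoids them with probability about exp (- k / d)
    ([leq_card_avoiding_tuples], [avoiding_density]).  Hence K has at least
    about m exp (- k / d) / 4 elements: a group pays either for links or for
    cells.  When k is below (1 - 3 a) d ln l this forces |K| > d ln l,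
    provided m is a small but fixed fraction of the number r of colours, so
    that each group costs (1 - 3 a) d ln l ([group_cost]).  The l groups cost
    (1 - 3 a) l d ln l, where l d is nearly r.

    The only limit on l is that the number of parts, about l^(3 l), be small
    against the square root of d.  This allows ln l = (1 - o(1)) ln (ln r),
    which gives the bound ([needs_paths_log]).  The function o(1) is obtained
    from the infimum of the errors admissible for r. *)

Local Open Scope nat_scope.

(** * Counting injective selectors *)

(** Choose the entries one at a time: entry i must avoid K i and the at most t
    entries already chosen.  Bounding by t rather than by i makes the estimate
    a product of independent factors. *)
Lemma leq_card_avoiding_tuples (d t n : nat) (K : 'I_n -> {set 'I_d}) :
  n <= t ->
  \prod_(i < n) (d - (t + #|K i|)) <=
    #|[set s : n.-tuple 'I_d | uniq s && [forall i, tnth s i \notin K i]]|.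
Proof.
elim: n K => [|n IHn] K lt_nt.
  rewrite big_ord0 card_gt0; apply/set0Pn; exists [tuple].
  by rewrite inE; apply/forallP => -[].
rewrite big_ord_recl -sum1dep_card.
pose K' (i : 'I_n) := K (lift ord0 i).
set S := [set s : n.-tuple 'I_d | uniq s && [forall i, tnth s i \notin K' i]].
pose Q (s : n.-tuple 'I_d) (x : 'I_d) := x \notin K ord0 :|: [set y in s].
have cardQ s : d - (t + #|K ord0|) <= #|[pred x | Q s x]|.
  have -> : #|[pred x | Q s x]| = #|~: (K ord0 :|: [set y in s])|.
    by apply: eq_card => x; rewrite !inE /Q !inE.
  rewrite [leqRHS]cardsCs finset.setCK card_ord leq_sub2l // addnC.
  apply: leq_trans (leq_card_setU _ _) _; rewrite leq_add2l cardsE.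
  by apply: leq_trans (card_size _) _; rewrite size_tuple ltnW.
(* Split the sequences by their tail, then count the possible heads. *)
pose ttail (s : n.+1.-tuple 'I_d) := [tuple of behead s].
rewrite (partition_big ttail [in S]) /=; last first.
  move=> s; case/tupleP: s => x s; rewrite /S inE /= => /andP[/andP[_ us]].
  move/forallP=> avs; have -> : ttail [tuple of x :: s] = s by apply: val_inj.
  rewrite us; apply/forallP=> i; have := avs (lift ord0 i).
  by rewrite tnthS.
rewrite mulnC.
have leS : \prod_(i < n) (d - (t + #|K (lift ord0 i)|)) <= #|S|.
  by apply: IHn; apply: ltnW.
apply: leq_trans (leq_mul leS (leqnn _)) _.
rewrite -sum_nat_const; apply: leq_sum => s; rewrite inE => /andP[us avs].
apply: leq_trans (cardQ s) _; rewrite -sum1_card.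
pose cns (x : 'I_d) := [tuple of x :: s].
rewrite [leqRHS](reindex_onto cns (@thead _ _)) /=; last first.
  move=> s' /andP[_ /eqP def_s]; rewrite /cns; apply: val_inj => /=; rewrite -def_s.
  by case/tupleP: s' {def_s} => y s'.
rewrite leq_eqVlt; apply/orP; left; apply/eqP; apply: eq_bigl => x.
rewrite !inE /Q !inE negb_or; have -> : thead (cns x) = x by [].
have -> : ttail (cns x) = s by apply: val_inj.
rewrite !eqxx !andbT /= us andbT andbC; congr (_ && _).
apply/idP/forallP => [xK i | /(_ ord0)]; last by rewrite tnth0.
case: (unliftP ord0 i) => [j|] ->; last by rewrite tnth0.
by rewrite tnthS; apply: (forallP avs).
Qed.

Lemma leq_card_uniq_tuples (d t : nat) :
  #|{: {s : t.-tuple 'I_d | uniq s}}| <= d ^ t.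
Proof.
by rewrite card_sig (leq_trans (max_card _)) // card_tuple card_ord.
Qed.

(** * The colouring and its monochromatic components *)

Section Colouring.
Context (t m d l N : nat) (grp : 'I_t -> 'I_l).

Definition vertex : finType :=
  ('I_t * 'I_m * {s : t.-tuple 'I_d | uniq s} * 'I_N)%type.
Definition hue : finType := ('I_m + 'I_l * 'I_d)%type.
Definition component : finType := ('I_l * ('I_m + 'I_t * 'I_d))%type.

Definition part (v : vertex) : 'I_t := v.1.1.1.
Definition cell (v : vertex) : 'I_m := v.1.1.2.
Definition selector (v : vertex) : t.-tuple 'I_d := val v.1.2.
Definition group (v : vertex) : 'I_l := grp (part v).

Definition edge_hue (u v : vertex) : hue :=
  if group u == group v then
    inl (if cell u <= cell v then cell v else cell u)
  else if group u < group v then inr (group u, tnth (selector u) (part v))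
  else inr (group v, tnth (selector v) (part u)).

(** The label of the component of hue k through v.  A link c of group g
    determines, at a vertex of g, the part to which its selector assigns c;
    the default value of [insubd] concerns only values c that the selector
    misses, and then no edge at v has this hue. *)
Definition component_of (v : vertex) (k : hue) : component :=
  match k with
  | inl x => (group v, inl x)
  | inr (g, c) =>
      (g, inr (if group v == g then insubd (part v) (index c (selector v))
               else part v, c))
  end.

Lemma edge_hueC u v : edge_hue u v = edge_hue v u.
Proof.
rewrite /edge_hue eq_sym; case: eqVneq => [_|ne_g].
  by congr inl; case: (ltngtP (cell u) (cell v)) => // /val_inj.
by case: (ltngtP (group u) (group v)) => // /val_inj eq_g; rewrite eq_g eqxx in ne_g.
Qed.

Lemma insubd_index_selector u (i j : 'I_t) :
  insubd i (index (tnth (selector u) j) (selector u)) = j.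
Proof.
apply: val_inj; rewrite val_insubd (tnth_nth (tnth (selector u) j)).
by rewrite index_uniq ?size_tuple ?ltn_ord //; apply: (valP u.1.2).
Qed.

(** This is where injectivity of the selectors is used: from its end in the
    smaller group, an edge recovers the part of its other end. *)
Lemma component_of_edge u v :
  component_of u (edge_hue u v) = component_of v (edge_hue u v).
Proof.
rewrite /edge_hue; case: (eqVneq (group u) (group v)) => [eq_g|ne_g] /=.
  by rewrite eq_g.
have ne_g' : (group v == group u) = false by rewrite eq_sym; apply: negPf.
by case: ifP => _ /=; rewrite !eqxx ?(negPf ne_g) ?ne_g' insubd_index_selector.
Qed.

Definition hue_path (p : seq vertex) : bool :=
  if p is x :: q then [exists k, path (fun u v => edge_hue u v == k) x q]
  else false.

Definition path_component (p : seq vertex) : option component :=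
  if p is x :: q then
    omap (component_of x) [pick k | path (fun u v => edge_hue u v == k) x q]
  else None.

Definition used_components (P : seq (seq vertex)) : {set component} :=
  [set a in pmap path_component P].

Lemma card_used_components P : #|used_components P| <= size P.
Proof.
by rewrite cardsE (leq_trans (card_size _)) // size_pmap count_size.
Qed.

Lemma hue_path_component x q (k : hue) :
  path (fun u v => edge_hue u v == k) x q ->
  path (fun u v => component_of u (edge_hue u v) == component_of x k) x q.
Proof.
elim: q x => //= y q IHq x /andP[/eqP xyk pq]; rewrite xyk eqxx /=.
suff -> : component_of x k = component_of y k by apply: IHq.
by rewrite -xyk component_of_edge.
Qed.

Lemma used_hue_path P p : p \in P -> hue_path p ->
  if p is x :: q then
    path (fun u v => component_of u (edge_hue u v) \in used_components P) x q
  else false.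
Proof.
case: p => [|x q] // pP /existsP[k0 pk0].
have [k pk Hk] : exists2 k, path (fun u v => edge_hue u v == k) x q &
    path_component (x :: q) = Some (component_of x k).
  rewrite /path_component; case: pickP => [k pk|/(_ k0)]; first by exists k.
  by rewrite pk0.
apply: sub_path (hue_path_component pk) => u v /eqP ->.
by rewrite inE mem_pmap; apply/mapP; exists (x :: q).
Qed.

(** Injecting each vertex of X into its successor misses only the last vertex
    of the path, which accounts for the extra unit. *)
Lemma count_path_succ (T : Type) (e : rel T) (X Y : pred T) x q :
    (forall u v, e u v -> X u -> Y v) -> path e x q ->
  count X (x :: q) <= (count Y (x :: q)).+1.
Proof.
move=> eXY exq; suff : count X (x :: q) <= (count Y q).+1.
  by move/leq_trans; apply; rewrite ltnS /= leq_addl.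
elim: q x exq => [|y q IHq] x /=; first by case: (X x).
case/andP=> /eXY XxYy /IHq /=; case: (X x) XxYy => [-> //|_]; lia.
Qed.

Definition used_cells (A : {set component}) (g : 'I_l) : {set 'I_m} :=
  [set x | (g, inl x) \in A].
Definition used_links (A : {set component}) (g : 'I_l) (j : 'I_t) : {set 'I_d} :=
  [set c | (g, inr (j, c)) \in A].

Lemma card_components (A : {set component}) :
  #|A| = \sum_g (#|used_cells A g| + \sum_j #|used_links A g j|).
Proof.
rewrite -sum1_card (eq_bigl (fun a => true && ((a.1, a.2) \in A))); last by case.
rewrite -(pair_big_dep xpredT (fun g a => (g, a) \in A) (fun _ _ => 1)) /=.
apply: eq_bigr => g _; rewrite big_sumType /=; congr (_ + _).
  by rewrite sum1dep_card.
rewrite (eq_bigl (fun a => true && ((g, inr (a.1, a.2)) \in A))); last by case.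
rewrite -(pair_big_dep xpredT (fun j c => (g, inr (j, c)) \in A) (fun _ _ => 1)).
by apply: eq_bigr => j _; rewrite /= sum1dep_card.
Qed.

Lemma leq_card_succ P (X Y : {set vertex}) :
    all hue_path P -> perm_eq (flatten P) (enum vertex) ->
    (forall u v, component_of u (edge_hue u v) \in used_components P ->
       u \in X -> v \in Y) ->
  #|X| <= #|Y| + size P.
Proof.
move=> hP pP XY.
have cnt (Z : {set vertex}) : #|Z| = count [in Z] (flatten P).
  by move/permP: pP => ->; rewrite enumT -size_filter cardE /enum_mem.
rewrite !cnt.
have sumP Q : {subset Q <= P} ->
    count [in X] (flatten Q) <= count [in Y] (flatten Q) + size Q.
  elim: Q => //= p Q IHQ sQ; rewrite !count_cat.
  have pin : p \in P by apply: sQ; rewrite mem_head.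
  have {}IHQ := IHQ (fun q qQ => sQ _ (mem_behead (s := p :: Q) qQ)).
  have := used_hue_path pin (allP hP _ pin).
  case: (p) => // x q exq.
  have := count_path_succ XY exq.
  move=> le_p; apply: leq_trans (leq_add le_p IHQ) _.
  by rewrite addSn addnS addnA.
exact: sumP.
Qed.

Lemma card_vertices (B : {set 'I_t}) (C : {set 'I_m})
    (S : {set {s : t.-tuple 'I_d | uniq s}}) :
  #|[set v : vertex | [&& part v \in B, cell v \in C & v.1.2 \in S]]| =
    #|B| * #|C| * #|S| * N.
Proof.
rewrite -[X in _ * X](card_ord N) -cardsT -!cardsX; apply: eq_card => -[[[j x] s] i].
by rewrite !inE /= andbT andbA.
Qed.

(** Every edge of the partition at a vertex of X leads into Y1 or Y2: towards
    an earlier group it ends in Y1; inside g its hue is a used cell, which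
    cannot be that of the end in X; towards a later group its link is used, so
    the part it reaches must be one of those in J. *)
Lemma group_inequality P (g : 'I_l) (J : {set 'I_t})
    (K := used_cells (used_components P) g)
    (L := used_links (used_components P) g) :
    all hue_path P -> perm_eq (flatten P) (enum vertex) ->
  #|[set j | grp j == g]| * (m - #|K|) *
    #|[set s : {s : t.-tuple 'I_d | uniq s} |
        [forall j, (j \in J) || (tnth (val s) j \notin L j)]]| * N <=
  (#|[set j | grp j < g]| + #|J|) * m * #|{: {s : t.-tuple 'I_d | uniq s}}| * N
  + #|[set j | grp j == g]| * #|K| * #|{: {s : t.-tuple 'I_d | uniq s}}| * N
  + size P.
Proof.
move=> hP pP; set S := [set s : {s : t.-tuple 'I_d | uniq s} | _].
pose X := [set v : vertex | [&& part v \in [set j | grp j == g],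
                               cell v \in ~: K & v.1.2 \in S]].
pose Y1 := [set v : vertex | [&& part v \in [set j | grp j < g] :|: J,
                               cell v \in [set: 'I_m]%SET &
                               v.1.2 \in [set: {s : t.-tuple 'I_d | uniq s}]%SET]].
pose Y2 := [set v : vertex | [&& part v \in [set j | grp j == g],
                               cell v \in K &
                               v.1.2 \in [set: {s : t.-tuple 'I_d | uniq s}]%SET]].
have XY u v : component_of u (edge_hue u v) \in used_components P ->
    u \in X -> v \in Y1 :|: Y2.
  have inK x : ((g, inl x) \in used_components P) = (x \in K) by rewrite [RHS]inE.
  have inK' x : ((g, inl x) \in pmap path_component P) = (x \in K).
    by rewrite [RHS]inE finset.in_set.
  have inL j c : ((g, inr (j, c)) \in used_components P) = (c \in L j).
    by rewrite [RHS]inE.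
  move=> uvP; rewrite finset.in_set => /and3P[].
  rewrite finset.in_set => /eqP gu; rewrite finset.in_setC => xuK.
  rewrite /S finset.in_set => /forallP su.
  rewrite -/(group u) in gu.
  rewrite finset.in_setU {}/Y1 {}/Y2 !(finset.in_set, finset.in_setU, finset.in_setT).
  rewrite -/(group v) !andbT -/(used_components P).
  move: uvP; rewrite component_of_edge /edge_hue gu.
  case: (eqVneq g (group v)) => [gv|ne_g] /=.
    rewrite -gv inK inK'; case: ifP => _ xK; rewrite ?xK ?orbT //.
    by rewrite xK in xuK.
  case: ltnP => [lt_g|le_g] /=; last first.
    by rewrite ltn_neqAle le_g andbT (inj_eq val_inj) eq_sym ne_g.
  rewrite eq_sym (negPf ne_g) inL => vK; have := su (part v).
  by rewrite vK => /orP[->|//]; rewrite orbT.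
have <- : #|~: K| = m - #|K| by rewrite cardsCs finset.setCK card_ord.
rewrite -card_vertices.
apply: leq_trans (leq_card_succ hP pP XY) _; rewrite leq_add2r.
apply: leq_trans (leq_card_setU _ _) _; rewrite !card_vertices !cardsT card_ord.
by rewrite leq_add2r !leq_mul // leq_card_setU.
Qed.

End Colouring.

(** * The cost of covering one group *)

Lemma card_uniq_tuples_sub (t d : nat) (Q : pred (t.-tuple 'I_d)) :
  #|[set s : {s : t.-tuple 'I_d | uniq s} | Q (val s)]| =
    #|[set s : t.-tuple 'I_d | uniq s && Q s]|.
Proof.
rewrite -(card_imset _ val_inj); apply: eq_card => s; rewrite !inE.
apply/imsetP/andP => [[[s' us']]|[us Qs]].
  by rewrite inE => Qs' ->.
by exists (exist _ s us) => //; rewrite inE.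
Qed.

Section Numeric.
Local Open Scope ring_scope.
Context (R : realType).
Implicit Types (a z x : R).

(** The inverse of 1 - z is 1 + z / (1 - z), at most exp (z / (1 - z)). *)
Lemma expR_le_subr1 a z : 0 <= z -> z <= a -> a < 1 ->
  expR (- (z / (1 - a))) <= 1 - z.
Proof.
move=> z0 za a1; rewrite expRN -[leRHS]invrK lef_pV2 ?posrE ?expR_gt0 //; last first.
  by rewrite invr_gt0; lra.
apply: le_trans (expR_ge1Dx _).
rewrite -[X in X <= _]mul1r ler_pdivrMr; last lra.
have : z <= z / (1 - a) * (1 - z).
  rewrite mulrAC ler_pdivlMr; last lra.
  by rewrite ler_wpM2l //; lra.
by rewrite mulrDl mul1r; lra.
Qed.

Lemma expR_ge_sqr x : 0 <= x -> x ^+ 2 / 4 <= expR x.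
Proof.
move=> x0; have h : x / 2 <= expR (x / 2).
  by apply: le_trans (expR_ge1Dx _); lra.
have -> : x ^+ 2 / 4 = x / 2 * (x / 2) by field.
by rewrite [in leRHS](splitr x) expRD ler_pM // divr_ge0.
Qed.

Lemma avoiding_density (a : R) (t d : nat) (k : 'I_t -> nat) :
    0 < a -> a < 1 -> (0 < d)%N ->
    (forall j, (t + k j)%:R <= a * d%:R) ->
  expR (- (\sum_j (t + k j)%:R / d%:R / (1 - a))) * (d ^ t)%:R <=
    (\prod_j (d - (t + k j)))%:R :> R.
Proof.
move=> a0 a1 d0 kd; have dR : 0 < d%:R :> R by rewrite ltr0n.
rewrite -sumrN expR_sum natrX -[t in X in _ * X]card_ord -prodr_const -big_split /=.
rewrite natr_prod; apply: ler_prod => j _.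
rewrite mulr_ge0 ?expR_ge0 ?ler0n //=.
have le_d : (t + k j <= d)%N.
  by rewrite -(ler_nat R); apply: le_trans (kd j) _; rewrite ler_piMl ?ltW.
rewrite natrB // -ler_pdivlMr // mulrBl divff ?gt_eqF //.
by apply: expR_le_subr1; rewrite // ler_pdivrMr.
Qed.

(** The inequality for one group, with p the density of avoiding selectors, ng
    the number of parts of the group, q the number of parts in earlier groups
    or in J, and kap the number of used cells.  The q parts absorb at most half
    of the weight m p, and a used cell counts twice in the rest: it absorbs
    vertices, and its own vertices need not be absorbed.  Hence the 4. *)
Lemma missing_cells (p m kap ng q av M : R) :
    0 < p -> p <= 1 -> 0 < ng -> 0 < M -> 0 <= kap -> kap <= m ->
    p * M <= av -> q <= ng * p / 2 ->
    ng * (m - kap) * av <= q * m * M + ng * kap * M ->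
  m * p <= 4 * kap.
Proof.
move=> p0 p1 ng0 M0 kap0 kapm pav qng H.
have m0 : 0 <= m by apply: le_trans kapm.
have H1 : ng * (m - kap) * (p * M) <= ng * (m - kap) * av.
  by rewrite ler_wpM2l // mulr_ge0 ?(ltW ng0) // subr_ge0.
have H2 : q * m * M <= ng * p / 2 * m * M.
  by rewrite !ler_wpM2r // ltW.
have H3 : (ng * M) * ((m - kap) * p) <= (ng * M) * (p / 2 * m + kap).
  have -> : ng * M * ((m - kap) * p) = ng * (m - kap) * (p * M) by ring.
  have -> : ng * M * (p / 2 * m + kap) = ng * p / 2 * m * M + ng * kap * M by ring.
  by lra.
rewrite ler_pM2l ?mulr_gt0 // in H3.
have : kap * p <= kap * 1 by rewrite ler_wpM2l.
by lra.
Qed.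
End Numeric.

Section Cost.
Local Open Scope ring_scope.
Context (R : realType) (a : R) (t m d l N : nat) (grp : 'I_t -> 'I_l).
Context (a0 : 0 < a) (a3 : a < 1 / 3) (t0 : (0 < t)%N) (l1 : (1 < l)%N).
Local Notation L := (ln (l%:R : R)).
Context (sizes : forall g : 'I_l, (2 * l * (#|[set j | (grp j < g)%N]| + l) <=
                            #|[set j | grp j == g]|)%N).
Context (few_parts : 2 * t%:R ^+ 2 <= a * d%:R).
Context (L1 : 1 <= L) (Ll : 2 * L / a + 1 <= l%:R).
Context (many_cells : 4 * (d%:R * L) < m%:R * expR (- ((1 - a) * L))).

(** Suppose the group costs less.  Put in J the parts with more than a d / 2
    used links: there are fewer than l of them.  For the others each factor of
    the avoidance probability is at least 1 - a, which makes the exponential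
    estimate of the product nearly sharp; as the used links number less than
    (1 - 3 a) d L, where L = ln l, the probability is at least
    p = exp (- (1 - a) L).  Then [missing_cells] gives m p <= 4 d L. *)
Lemma group_cost P (g : 'I_l) :
    all (@hue_path t m d l N grp) P -> perm_eq (flatten P) (enum (vertex t m d N)) ->
    (size P <= N)%N -> (0 < N)%N ->
  (1 - 3 * a) * (d%:R * L) <=
    (#|used_cells (used_components grp P) g| +
     \sum_j #|used_links (used_components grp P) g j|)%:R.
Proof.
move=> hP pP PN N0; rewrite leNgt; apply/negP.
move: (a0) (a3) (few_parts) (L1) (Ll) (many_cells) => a_gt0 a_lt t2 L_ge1 l_ge dLm.
set K := used_cells _ _; set U := used_links _ _ => cost.
have tR : 1 <= t%:R :> R by rewrite ler1n.
have dR : 0 < d%:R :> R.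
  rewrite -(pmulr_rgt0 _ a0); apply: lt_le_trans few_parts.
  by rewrite mulr_gt0 // exprn_gt0 //; lra.
have d0 : (0 < d)%N by rewrite -(ltr0n R).
have L0 : 0 < L by apply: lt_le_trans L1.
have dL0 : 0 < d%:R * L by rewrite mulr_gt0.
have costD : (\sum_j #|U j|)%:R < (1 - 3 * a) * (d%:R * L).
  by apply: le_lt_trans cost; rewrite ler_nat leq_addl.
have costI : #|K|%:R <= d%:R * L.
  apply: le_trans (_ : (1 - 3 * a) * (d%:R * L) <= _).
    by apply: le_trans (ltW cost); rewrite ler_nat leq_addr.
  by rewrite ler_piMl ?(ltW dL0) //; lra.
pose J := [set j | a * d%:R / 2 < #|U j|%:R].
have cardJ : (#|J| < l)%N.
  rewrite -(ltr_nat R); apply: lt_le_trans Ll.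
  have : #|J|%:R * (a * d%:R / 2) <= (\sum_j #|U j|)%:R.
    rewrite (bigID [in J]) /= natrD -[leLHS]addr0 lerD ?ler0n //.
    rewrite natr_sum mulr_natl -sumr_const; apply: ler_sum => j.
    by rewrite inE => /ltW.
  have dLa : d%:R * L = (2 * L / a) * (a * d%:R / 2) by field; lra.
  move=> H; have {H} : #|J|%:R * (a * d%:R / 2) <= 2 * L / a * (a * d%:R / 2).
    rewrite -dLa; apply: le_trans H _; apply: le_trans (ltW costD) _.
    by rewrite ler_piMl ?(ltW dL0) //; lra.
  rewrite ler_pM2r; last by rewrite divr_gt0 // mulr_gt0.
  by move=> h; lra.
(* Emptying U on J turns the exceptional parts into unconstrained ones. *)
pose U' j := if j \in J then finset.set0 else U j.
have U'd j : (t + #|U' j|)%:R <= a * d%:R.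
  have tt : 2 * t%:R <= a * d%:R :> R.
    by apply: le_trans few_parts; rewrite ler_pM2l // expr2 ler_peMr //; lra.
  rewrite natrD /U' inE; case: ltP => [_|le_j]; first by rewrite cards0 /=; lra.
  by rewrite /=; lra.
set p := expR (- ((1 - a) * L)).
have pM : p * (d ^ t)%:R <= (\prod_j (d - (t + #|U' j|)))%:R.
  apply: le_trans (avoiding_density (k := fun j => #|U' j|) a0 _ d0 U'd); last lra.
  rewrite ler_wpM2r ?ler0n // ler_expR lerN2 -mulr_suml ler_pdivrMr; last lra.
  rewrite -mulr_suml ler_pdivrMr // -natr_sum big_split /= sum_nat_const card_ord.
  rewrite natrD natrM -expr2.
  have : (\sum_j #|U' j|)%:R <= (\sum_j #|U j|)%:R :> R.
    rewrite ler_nat; apply: leq_sum => j _; rewrite /U'.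
    by case: ifP => _ //; rewrite cards0.
  have : a * d%:R <= a * d%:R * L.
    by rewrite ler_peMr // mulr_ge0 // ltW.
  have : (1 - 2 * a) * (d%:R * L) <= (1 - a) * L * (1 - a) * d%:R.
    have -> : (1 - a) * L * (1 - a) * d%:R = (1 - 2 * a + a ^+ 2) * (d%:R * L) by ring.
    by rewrite ler_wpM2r ?(ltW dL0) // lerDl sqr_ge0.
  by have := mulr_ge0 (ltW a_gt0) (ltW dL0); move: costD; lra.
have p0 : 0 < p by apply: expR_gt0.
have p1 : p <= 1.
  by rewrite -expR0 ler_expR oppr_le0 mulr_ge0 //; lra.
have lR : 0 < l%:R :> R by rewrite ltr0n ltnW.
have pl : l%:R^-1 <= p.
  rewrite -[X in X^-1]lnK ?posrE // -expRN ler_expR lerN2.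
  by rewrite ler_piMl //; lra.
set M := #|{: {s : t.-tuple 'I_d | uniq s}}|.
set S := [set s : {s : t.-tuple 'I_d | uniq s} |
           [forall j, (j \in J) || (tnth (val s) j \notin U j)]].
have leS : (\prod_j (d - (t + #|U' j|)) <= #|S|)%N.
  apply: leq_trans (leq_card_avoiding_tuples _ (leqnn t)) _.
  rewrite /S (card_uniq_tuples_sub (fun s : t.-tuple 'I_d =>
    [forall j, (j \in J) || (tnth s j \notin U j)])).
  apply/subset_leq_card/fintype.subsetP => s; rewrite !finset.in_set => /andP[-> /forallP H].
  apply/forallP => j; have := H j; rewrite /U'; case: ifP => //.
have pS : p * M%:R <= #|S|%:R.
  apply: le_trans (_ : (\prod_j (d - (t + #|U' j|)))%:R <= _); last by rewrite ler_nat.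
  apply: le_trans pM; rewrite ler_wpM2l ?(ltW p0) // ler_nat.
  exact: leq_card_uniq_tuples.
have M0 : (0 < M)%N.
  apply: leq_trans (max_card S); rewrite -(ltr0n R).
  apply: lt_le_trans (_ : p * (d ^ t)%:R <= _).
    by rewrite mulr_gt0 // ltr0n expn_gt0 d0.
  by apply: le_trans pM _; rewrite ler_nat.
have m0 : (0 < m)%N.
  rewrite -(ltr0n R) -(pmulr_lgt0 _ p0); apply: le_lt_trans many_cells.
  by rewrite mulr_ge0 ?(ltW dL0).
have Km : (#|K| <= m)%N by rewrite -[leqRHS]card_ord max_card.
have ineq : (#|[set j | grp j == g]| * (m - #|K|) * #|S| <=
  (#|[set j | (grp j < g)%N]| + #|J| + 1) * m * M + #|[set j | grp j == g]| * #|K| * M)%N.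
  rewrite -(leq_pmul2r N0); apply: leq_trans (group_inequality g J hP pP) _.
  rewrite -/K -/M.
  set n1 := (_ + #|J|)%N; set n2 := #|[set j | grp j == g]|.
  have -> : (((n1 + 1) * m * M + n2 * #|K| * M) * N =
    n1 * m * M * N + n2 * #|K| * M * N + m * M * N)%N by ring.
  rewrite leq_add2l.
  by apply: leq_trans PN _; rewrite leq_pmull // muln_gt0 m0.
have := sizes g; rewrite -(ler_nat R) => sg.
have ng0 : 0 < #|[set j | grp j == g]|%:R :> R.
  apply: lt_le_trans sg; rewrite ltr0n !muln_gt0 addn_gt0 /=.
  by rewrite (ltnW l1) orbT.
have := missing_cells (m := m%:R) (kap := #|K|%:R) (av := #|S|%:R) (M := M%:R)
  (q := (#|[set j | (grp j < g)%N]| + #|J| + 1)%:R) p0 p1 ng0.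
rewrite ltr0n M0 ler0n ler_nat Km pS -natrB // -!natrM -natrD ler_nat ineq.
move=> /(_ isT isT isT isT) H.
have {H} : m%:R * p <= (4 * #|K|)%:R.
  apply: H => //; apply: le_trans (_ : (#|[set j | (grp j < g)%N]| + l)%:R <= _).
    by rewrite ler_nat -addnA leq_add2l addn1.
  set q := (_ + l)%N in sg *.
  have h : #|[set j | grp j == g]|%:R * l%:R^-1 <= #|[set j | grp j == g]|%:R * p.
    by rewrite ler_wpM2l // ltW.
  have : q%:R <= #|[set j | grp j == g]|%:R * l%:R^-1 / 2 :> R.
    rewrite ler_pdivlMr // ler_pdivlMr //; apply: le_trans sg.
    by rewrite !natrM le_eqVlt; apply/orP; left; apply/eqP; ring.
  by move=> h2; lra.
rewrite natrM; have : 4 * #|K|%:R <= 4 * (d%:R * L) by rewrite ler_pM2l.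
by move: dLm; rewrite -/p; lra.
Qed.

Lemma partition_cost P :
    all (@hue_path t m d l N grp) P -> perm_eq (flatten P) (enum (vertex t m d N)) ->
    (size P <= N)%N -> (0 < N)%N ->
  (1 - 3 * a) * ((l * d)%:R * L) <= (size P)%:R.
Proof.
move=> hP pP PN N0.
apply: le_trans (_ : #|used_components grp P|%:R <= _); last first.
  by rewrite ler_nat card_used_components.
rewrite card_components natr_sum natrM.
have -> : (1 - 3 * a) * (l%:R * d%:R * L) =
    \sum_(g < l) (1 - 3 * a) * (d%:R * L).
  by rewrite sumr_const card_ord -mulr_natl; ring.
by apply: ler_sum => g _; apply: group_cost.
Qed.
End Cost.

(** * Realization on an initial segment *)

(** Part j goes to the group of its leading exponent in base b; the inclusion
    of 0 in the first group is harmless. *)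
Lemma geometric_grouping (b l : nat) : 1 < b -> 0 < l ->
  exists grp : 'I_(b ^ l) -> 'I_l, forall g : 'I_l,
    #|[set j | grp j < g]| <= b ^ g /\
    b ^ g * b.-1 <= #|[set j | grp j == g]|.
Proof.
move=> b1 l0; pose grp (j : 'I_(b ^ l)) : 'I_l := insubd (Ordinal l0) (trunc_log b j).
have grpE j : grp j = trunc_log b j :> nat.
  rewrite val_insubd; case: ifPn => //; case: (posnP j) => [->|j0].
    by rewrite trunc_log0 l0.
  case/andP: (trunc_log_bounds b1 j0) => le_j _ /negP[].
  by rewrite -(ltn_exp2l _ _ b1); apply: leq_ltn_trans le_j (ltn_ord j).
have bg (g : 'I_l) : b ^ g.+1 <= b ^ l by rewrite leq_exp2l.
exists grp => g; split.
  have le_bg : b ^ g <= b ^ l by apply: leq_trans (bg g); rewrite leq_exp2l.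
  apply: leq_trans (_ : #|[set widen_ord le_bg i | i in 'I_(b ^ g)]| <= _); last first.
    by rewrite (leq_trans (leq_imset_card _ _)) // card_ord.
  apply/subset_leq_card/fintype.subsetP => j; rewrite inE grpE => lt_g.
  have lt_j : j < b ^ g.
    case: (posnP j) => [->|j0]; first by rewrite expn_gt0 ltnW.
    case/andP: (trunc_log_bounds b1 j0) => _ /leq_trans; apply.
    by rewrite leq_exp2l.
  by apply/imsetP; exists (Ordinal lt_j) => //; apply: val_inj.
have def_bg : b ^ g.+1 = b ^ g + b ^ g * b.-1.
  by rewrite -mulnS prednK ?expnSr // ltnW.
have lt_bl (i : 'I_(b ^ g * b.-1)) : b ^ g + i < b ^ l.
  by apply: leq_trans (bg g); rewrite def_bg ltn_add2l.
pose f i := Ordinal (lt_bl i).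
have f_inj : injective f by move=> i j /(congr1 val) /= /addnI /val_inj.
rewrite -{1}[b ^ g * b.-1]card_ord -(card_imset _ f_inj).
apply/subset_leq_card/fintype.subsetP => j /imsetP[i _ ->].
rewrite inE -(inj_eq val_inj) /= grpE /=; apply/eqP/trunc_log_eq => //.
by rewrite leq_addr def_bg ltn_add2l /=.
Qed.

Lemma hue_colouring (t m d l N r : nat) (grp : 'I_t -> 'I_l) :
    m + l * d = r ->
  exists c : 'I_#|vertex t m d N| -> 'I_#|vertex t m d N| -> 'I_r,
    edge_colouring c /\
    forall P, mono_path_partition c P ->
      all (hue_path grp) (map (map enum_val) P) /\
      perm_eq (flatten (map (map enum_val) P)) (enum (vertex t m d N)).
Proof.
move=> def_r; have cardE : #|hue m d l| = r.
  by rewrite card_sum card_prod !card_ord.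
pose f k := cast_ord cardE (enum_rank k).
have f_inj : injective f by move=> k k' /cast_ord_inj /enum_rank_inj.
exists (fun x y => f (edge_hue grp (enum_val x) (enum_val y))).
split=> [x y|P /andP[/allP monoP partP]]; first by rewrite edge_hueC.
split.
  apply/allP => _ /mapP[p /monoP pP ->]; case: p pP => //= x q /andP[_].
  case/existsP => k pk; apply/existsP; exists (enum_val (cast_ord (esym cardE) k)).
  rewrite path_map; apply: sub_path pk => u v /andP[_ /eqP <-] /=.
  by rewrite /f cast_ordK enum_rankK.
rewrite -map_flatten; apply: perm_trans (perm_map _ partP) _.
apply: uniq_perm; rewrite ?enum_uniq //.
  by rewrite map_inj_uniq ?enum_uniq //; apply: enum_val_inj.
move=> v; rewrite mem_enum; apply/mapP; exists (enum_rank v).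
  by rewrite mem_enum.
by rewrite enum_rankK.
Qed.

Lemma card_vertex_gt (t m d N : nat) : 0 < t -> 0 < m -> t < d ->
  N <= #|vertex t m d N|.
Proof.
move=> t0 m0 td; rewrite !card_prod !card_ord leq_pmull // !muln_gt0 t0 m0 /=.
have := leq_card_avoiding_tuples (fun _ : 'I_t => finset.set0 : {set 'I_d}) (leqnn t).
rewrite card_sig; under eq_bigr do rewrite cards0 addn0.
rewrite prod_nat_const => /leq_trans H; apply: leq_trans (H _ _).
  by rewrite expn_gt0 subn_gt0 td.
by apply/subset_leq_card/fintype.subsetP => s; rewrite !inE => /andP[].
Qed.

(** * Choice of the parameters *)

Lemma largest_self_power (l0 r : nat) : 0 < l0 -> (l0 ^ (10 * l0) <= r) ->
  exists l, [/\ (l0 <= l), (l ^ (10 * l) <= r) &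
                (r < l.+1 ^ (10 * l.+1))].
Proof.
move=> l0_gt0 le_r.
have bnd l : (l ^ (10 * l) <= r) -> (l <= r).
  case: l => // l; apply: leq_trans.
  by have := @leq_pexp2l l.+1 1 (10 * l.+1) isT isT; rewrite expn1.
have ex : exists l, (l ^ (10 * l) <= r) by exists l0.
have [l lr lmax] := ex_maxnP ex bnd; exists l; split=> //; first exact: lmax.
by rewrite ltnNge; apply/negP => /lmax; rewrite ltnn.
Qed.

Definition needs_paths (R : realType) (r : nat) (x : R) : Prop :=
  forall n0 : nat, exists n : nat, n0 < n /\
    exists c : 'I_n -> 'I_n -> 'I_r, edge_colouring c /\
      ~ exists P : seq (seq 'I_n),
          mono_path_partition c P /\ ((size P)%:R < x)%R.

Section Choice.
Local Open Scope ring_scope.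
Context (R : realType).

Lemma needs_paths_le r (x y : R) : y <= x -> needs_paths r x -> needs_paths r y.
Proof.
move=> le_yx H n0; have [n [lt_n [c [symc noP]]]] := H n0.
exists n; split => //; exists c; split => // -[P [partP ltP]].
by apply: noP; exists P; split => //; apply: lt_le_trans le_yx.
Qed.

(** With base l^3, the parts of a group exceed those of all earlier groups
    together by a factor of order l^3, which leaves room for the fewer than l
    parts in J after multiplication by 2 l, a bound for 2 / p.  The copies N
    exceed both n0 and the number of paths, which makes the last vertices of
    the paths negligible. *)
Lemma needs_paths_groups (a : R) (l d m : nat) :
    0 < a -> a < 1 / 3 -> (2 < l)%N ->
    2 * ((l ^ 3) ^ l)%:R ^+ 2 <= a * d%:R ->
    1 <= ln (l%:R : R) -> 2 * ln (l%:R) / a + 1 <= l%:R ->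
    4 * (d%:R * ln l%:R) < m%:R * expR (- ((1 - a) * ln l%:R)) ->
  needs_paths (m + l * d) ((1 - 3 * a) * ((l * d)%:R * ln l%:R)).
Proof.
move=> a0 a3 l2 few L1 Ll many n0; set x := _ * _.
have l0 : (0 < l)%N by apply: leq_trans l2.
have b1 : (1 < l ^ 3)%N by rewrite -(expn0 l) ltn_exp2l // ltnW.
have [grp grpP] := geometric_grouping b1 l0.
set t := ((l ^ 3) ^ l)%N in few grp grpP.
have t0 : (0 < t)%N by rewrite expn_gt0 ltnW.
pose N := (n0 + Num.bound x).+1.
have [c [symc cP]] := @hue_colouring t m d l N _ grp erefl.
exists #|vertex t m d N|; split.
  apply: leq_trans (card_vertex_gt N t0 _ _); first by rewrite /N ltnS leq_addr.
    rewrite -(ltr0n R) -(pmulr_lgt0 _ (expR_gt0 (- ((1 - a) * ln l%:R)))).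
    apply: le_lt_trans many; rewrite !mulr_ge0 //.
    by apply: le_trans L1.
  rewrite -(ltr_nat R).
  have t1 : 1 <= t%:R :> R by rewrite ler1n.
  have : t%:R <= t%:R ^+ 2 :> R by rewrite expr2 ler_peMr //; lra.
  have : a * d%:R <= d%:R by rewrite ler_piMl //; lra.
  by lra.
exists c; split => // -[P [/cP[hueP partP] ltP]].
suff : x <= (size P)%:R by rewrite leNgt ltP.
rewrite -(size_map (map enum_val) P).
apply: (partition_cost (grp := grp) (N := N)) => //.
- exact: ltnW.
- move=> g; have [lt_g eq_g] := grpP g; apply: leq_trans eq_g.
  apply: leq_trans (_ : (2 * l * (l ^ 3) ^ g * (l + 1) <= _)%N).
    have p0 : (0 < (l ^ 3) ^ g)%N by rewrite !expn_gt0 l0.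
    rewrite -[leqRHS]mulnA leq_mul2l mulnDr muln1 addnC; apply/orP; right.
    by rewrite leq_add // leq_pmull.
  rewrite mulnAC [leqRHS]mulnC leq_mul2r; apply/orP; right.
  have : (3 * l ^ 2 <= l ^ 3)%N by rewrite [leqRHS]expnS leq_mul2r l2 orbT.
  by move: l2; clear; nia.
- rewrite size_map -(ler_nat R) ltW //; apply: lt_trans ltP _.
  have x0 : 0 <= x by rewrite mulr_ge0 ?mulr_ge0 //; lra.
  apply: lt_le_trans (archi_boundP x0) _.
  by rewrite ler_nat /N leqW // leq_addl.
Qed.

(** For l maximal with l^(10 l) <= r one has ln r < 10 (l + 1) ln (l + 1), so
    ln (ln r) <= (1 + a) ln l once l is large, while the l^(3 l) parts are few
    enough for d = (1 - a) r / l.  Every requirement on l reduces to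
    a^3 ln l >= 160. *)
Lemma needs_paths_log (a : R) : 0 < a -> a < 1 / 6 ->
  exists r0 : nat, forall r : nat, (r0 <= r)%N ->
    needs_paths r ((1 - 6 * a) * (r%:R * ln (ln (r%:R : R)))).
Proof.
move=> a0 a6; pose L0 : R := 160 / a ^+ 3.
have a30 : 0 < a ^+ 3 by rewrite exprn_gt0.
pose l0 := (Num.bound (expR L0) + 3)%N.
exists (l0 ^ (10 * l0))%N => r le_r.
have l0_gt0 : (0 < l0)%N by rewrite /l0 addnS.
have [l [l0l lr rl]] := largest_self_power l0_gt0 le_r.
have l3 : (3 <= l)%N by apply: leq_trans l0l; rewrite leq_addl.
have l_gt0 : (0 < l)%N by apply: leq_trans l3.
have l3R : 3 <= l%:R :> R by rewrite ler_nat.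
have lR : 0 < l%:R :> R by rewrite ltr0n.
set L : R := ln l%:R.
have lE : l%:R = expR L by rewrite /L lnK ?posrE.
have L0L : L0 <= L.
  rewrite -[L0]expRK ler_ln ?posrE ?expR_gt0 //.
  apply: le_trans (ltW (archi_boundP (expR_ge0 L0))) _; rewrite ler_nat.
  by apply: leq_trans l0l; rewrite leq_addr.
have L160 : 160 <= a ^+ 3 * L.
  by move: L0L; rewrite /L0 ler_pdivrMr // mulrC.
have a3a : a ^+ 3 <= a by rewrite exprS ler_piMr ?(ltW a0) // expr_le1 //; lra.
have a1L : 160 <= a * L.
  have L_ge0 : 0 <= L by rewrite ln_ge0 //; lra.
  by apply: le_trans L160 _; rewrite ler_wpM2r.
have L1 : 160 <= L.
  have L_ge0 : 0 <= L by rewrite ln_ge0 //; lra.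
  by apply: le_trans a1L _; rewrite ler_piMl //; lra.
have expaL : 40 * L <= a * expR (a * L).
  have : a * ((a * L) ^+ 2 / 4) <= a * expR (a * L).
    by rewrite ler_pM2l // expR_ge_sqr //; lra.
  apply: le_trans.
  have -> : a * ((a * L) ^+ 2 / 4) = (a ^+ 3 * L) * L / 4 by field.
  have : 160 * L <= a ^+ 3 * L * L by rewrite ler_pM2r //; lra.
  by lra.
have al1 : 1 <= a * l%:R.
  have : 1 + L <= l%:R by rewrite lE expR_ge1Dx.
  by move=> h; have : a * (1 + L) <= a * l%:R by [rewrite ler_pM2l //]; lra.
set u : R := ((l ^ 3) ^ l)%:R ^+ 2.
have u_gt0 : 0 < u by rewrite exprn_gt0 // ltr0n !expn_gt0 l_gt0.
have ur : u * l%:R ^+ 4 <= r%:R.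
  rewrite /u -!natrX -natrM ler_nat; apply: leq_trans lr.
  rewrite -!expnM -expnD leq_pexp2l //; lia.
have u1 : 1 <= u by rewrite exprn_ege1 // ler1n !expn_gt0 l_gt0.
have l4 : 4 <= l%:R ^+ 2 :> R.
  by have := ler_pM (ler0n R 3) (ler0n R 3) l3R l3R; rewrite -expr2; lra.
have ulr : 4 * (u * l%:R) <= a * r%:R.
  apply: le_trans (_ : a * (u * l%:R ^+ 4) <= _); last by rewrite ler_pM2l.
  have -> : a * (u * l%:R ^+ 4) = (a * l%:R) * (l%:R ^+ 2 * (u * l%:R)) by ring.
  have ul0 : 0 <= u * l%:R by rewrite mulr_ge0 ?ltW.
  apply: le_trans (_ : l%:R ^+ 2 * (u * l%:R) <= _); first by rewrite ler_wpM2r.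
  by rewrite ler_peMl // mulr_ge0 // exprn_ge0 // ltW.
have lar : l%:R <= a * r%:R.
  apply: le_trans ulr; have : l%:R <= u * l%:R by rewrite ler_peMl // ltW.
  by lra.
have r0 : 0 < r%:R :> R by rewrite -(pmulr_rgt0 _ a0); apply: lt_le_trans lar.
pose d := Num.truncn ((1 - a) * r%:R / l%:R).
have d_itv : d%:R <= (1 - a) * r%:R / l%:R < d.+1%:R.
  by apply: truncn_itv; rewrite divr_ge0 ?mulr_ge0 ?ltW //; lra.
have [ld_le ld_ge] : (l * d)%:R <= (1 - a) * r%:R :> R /\
    (1 - 2 * a) * r%:R <= (l * d)%:R :> R.
  case/andP: d_itv; rewrite ler_pdivlMr // ltr_pdivrMr // natrM -natr1 => h1 h2.
  by split; lra.
have ldr : (l * d <= r)%N.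
  by rewrite -(ler_nat R); apply: le_trans ld_le _; rewrite ler_piMl ?ltW //; lra.
have mE : (r - l * d)%:R = r%:R - (l * d)%:R :> R by rewrite natrB.
have am : a * r%:R <= (r - l * d)%:R by rewrite mE; lra.
rewrite -(subnK ldr).
have lnr : ln (ln (r%:R : R)) <= (1 + a) * L.
  have r1 : 1 < r%:R :> R.
    by have : a * r%:R <= r%:R by [rewrite ler_piMl ?ltW //; lra]; lra.
  rewrite -[leRHS]expRK ler_ln ?posrE ?expR_gt0 ?ln_gt0 //.
  have l1R : 0 < l.+1%:R :> R by rewrite ltr0n.
  have : ln (r%:R : R) <= ln (l.+1%:R ^+ (10 * l.+1)).
    by rewrite ler_ln ?posrE ?exprn_gt0 // -natrX ler_nat ltnW.
  move/le_trans; apply; rewrite lnXn // -[leLHS]mulr_natl natrM.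
  have ln1 : ln (l.+1%:R : R) <= L *+ 2.
    rewrite -lnXn // ler_ln ?posrE ?exprn_gt0 // -natrX ler_nat.
    by rewrite expnS expn1; move: l3; clear; nia.
  have ln0 : 0 <= ln (l.+1%:R : R) by rewrite ln_ge0 // ler1n.
  have l20 : 10 * l.+1%:R <= 20 * l%:R :> R by rewrite -natr1; lra.
  apply: le_trans (_ : 20 * l%:R * (L *+ 2) <= _).
    by rewrite ler_pM // mulr_ge0.
  have -> : (1 + a) * L = L + a * L by ring.
  rewrite expRD -lE.
  have -> : 20 * l%:R * (L *+ 2) = l%:R * (40 * L) by ring.
  rewrite ler_pM2l //; apply: le_trans expaL _.
  by rewrite ler_piMl ?expR_ge0 //; lra.
apply: needs_paths_le (_ : (1 - 3 * a) * ((l * d)%:R * L) >= _) _.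
  rewrite subnK //.
  apply: le_trans (_ : (1 - 3 * a) * ((1 - 2 * a) * r%:R * L) <= _); last first.
    rewrite ler_wpM2l //; first by lra.
    by rewrite ler_wpM2r //; lra.
  have -> : (1 - 3 * a) * ((1 - 2 * a) * r%:R * L) =
    (1 - 5 * a + 6 * a ^+ 2) * (r%:R * L) by ring.
  have rL : 0 <= r%:R * L by rewrite mulr_ge0 ?ltW //; lra.
  apply: le_trans (_ : (1 - 6 * a) * (r%:R * ((1 + a) * L)) <= _).
    by rewrite ler_wpM2l ?ler_wpM2l //; lra.
  have -> : (1 - 6 * a) * (r%:R * ((1 + a) * L)) =
    (1 - 5 * a - 6 * a ^+ 2) * (r%:R * L) by ring.
  by rewrite ler_wpM2r //; have := sqr_ge0 a; lra.
apply: needs_paths_groups => //; first by lra.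
- rewrite -/u -(ler_pM2r lR).
  have -> : a * d%:R * l%:R = a * (l * d)%:R by rewrite natrM; ring.
  have : a * ((1 - 2 * a) * r%:R) <= a * (l * d)%:R by rewrite ler_pM2l.
  have : 1 / 2 * (a * r%:R) <= (1 - 2 * a) * (a * r%:R).
    by rewrite ler_wpM2r ?mulr_ge0 ?ltW //; lra.
  by lra.
- by rewrite -/L; lra.
- rewrite -/L lE; apply: le_trans (expR_ge_sqr _); last by lra.
  have : 2 * L / a <= L * L / 8.
    rewrite ler_pdivrMr // mulrAC ler_pdivlMr //.
    have : 160 * L <= (L * a) * L by rewrite ler_wpM2r //; lra.
    by lra.
  have : 160 * L <= L * L by rewrite ler_wpM2r //; lra.
  by rewrite expr2; lra.
rewrite -/L.
have -> : - ((1 - a) * L) = a * L - L by ring.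
rewrite expRD expRN -lE [ltRHS]mulrA ltr_pdivlMr //.
apply: lt_le_trans (_ : a * r%:R * expR (a * L) <= _); last first.
  by rewrite ler_wpM2r ?expR_ge0.
have -> : 4 * (d%:R * L) * l%:R = (l * d)%:R * (4 * L) by rewrite natrM; ring.
apply: le_lt_trans (_ : r%:R * (4 * L) < _).
  by rewrite ler_wpM2r ?ler_nat //; lra.
have -> : a * r%:R * expR (a * L) = r%:R * (a * expR (a * L)) by ring.
by rewrite ltr_pM2l //; lra.
Qed.

End Choice.

Local Open Scope classical_set_scope.
Local Open Scope ring_scope.

(** * The theorem *)

Theorem theorem1p3 (R : realType) :
  exists eps : nat -> R,
    eps r @[r --> \oo] --> (0 : R) /\
    exists r0 : nat, forall r : nat, (r0 <= r)%N ->
      forall n0 : nat, exists n : nat, (n0 < n)%N /\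
        exists c : 'I_n -> 'I_n -> 'I_r, edge_colouring c /\
          ~ exists P : seq (seq 'I_n),
              mono_path_partition c P /\
              (size P)%:R < (1 - eps r) * (r%:R * ln (ln (r%:R : R))).
Proof.
pose E r := [set e : R | 0 <= e /\
  needs_paths r ((1 - e) * (r%:R * ln (ln (r%:R : R))))].
have E_lb r : lbound (E r) 0 by move=> e [].
have E_log (a : R) : 0 < a -> a < 1 / 6 ->
    exists r0 : nat, forall r : nat, (r0 <= r)%N -> E r (6 * a).
  move=> a0 a6; have [r0 H] := needs_paths_log a0 a6; exists r0 => r /H.
  by split => //; lra.
have E_inf (a : R) : 0 < a -> a < 1 / 6 ->
    exists r0 : nat, forall r : nat, (r0 <= r)%N -> 0 <= inf (E r) <= 6 * a.
  move=> a0 a6; have [r0 H] := E_log a a0 a6; exists r0 => r /H Er.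
  apply/andP; split; first by apply: lb_le_inf => //; exists (6 * a).
  by apply: ge_inf => //; exists 0; apply: E_lb.
exists (fun r => inf (E r) + r.+1%:R^-1); split.
  apply/cvgrPdist_lt => e e0.
  pose a := Num.min (e / 12) (1 / 12).
  have a0 : 0 < a by rewrite lt_min; apply/andP; split; lra.
  have [ae a12] : a <= e / 12 /\ a <= 1 / 12 by rewrite !ge_min !lexx orbT.
  have [r0 H] : exists r0 : nat, forall r : nat, (r0 <= r)%N ->
      0 <= inf (E r) <= 6 * a by apply: E_inf => //; lra.
  near=> r.
  have r_inv : r.+1%:R^-1 < e / 2.
    near: r; have /cvgrPdist_lt/(_ (e / 2)) := @cvg_harmonic R.
    rewrite divr_gt0 // => /(_ isT); apply: filterS => r.
    by rewrite /= sub0r normrN gtr0_norm // invr_gt0 ltr0n.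
  have /H/andP[i0 ia] : (r0 <= r)%N by near: r; apply: nbhs_infty_ge.
  have r_pos : 0 < r.+1%:R^-1 :> R by rewrite invr_gt0 ltr0n.
  rewrite sub0r normrN; set q := _^-1 in r_inv r_pos *; rewrite ger0_norm; lra.
have [r0 H] : exists r0 : nat, forall r : nat, (r0 <= r)%N -> E r (6 * (1 / 12)).
  by apply: E_log; lra.
exists (maxn r0 (Num.bound (expR (1 : R)))) => r; rewrite geq_max => /andP[r0r re].
(* The infimum need not be attained; the summand 1 / (r + 1) absorbs this. *)
have [||e [_ Ee] lt_e] := @inf_adherent _ (E r) r.+1%:R^-1.
- by rewrite invr_gt0 ltr0n.
- by split; [exists (6 * (1 / 12)); apply: H | exists 0; apply: E_lb].
apply: needs_paths_le Ee.
rewrite ler_wpM2r ?lerD2l ?lerN2 ?(ltW lt_e) //.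
rewrite mulr_ge0 ?ler0n // ln_ge0 // -[leLHS]expRK ler_ln ?posrE ?expR_gt0 //.
  by apply: le_trans (ltW (archi_boundP (expR_ge0 1))) _; rewrite ler_nat.
apply: lt_le_trans (expR_gt0 1) _.
by apply: le_trans (ltW (archi_boundP (expR_ge0 1))) _; rewrite ler_nat.
Unshelve. all: by end_near.
Qed.
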